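(* Let $n,m,T,r_{\mathrm{in}},r\ge 1$ be integers with $r\le Tr_{\mathrm{in}}\le\min(n,m)$, let $\beta\in[0,1]$, and for $t=1,\dots,T$ let $B^{(t)}\in\mathbb{R}^{n\times r_{\mathrm{in}}}$, $A^{(t)}\in\mathbb{R}^{r_{\mathrm{in}}\times m}$ with $\Delta W^{(t)}=B^{(t)}A^{(t)}\neq 0$. Let $\Delta W^{(t)}_{\mathrm{target}}\in\mathbb{R}^{n\times m}$, $U_B\in\mathbb{R}^{n\times Tr_{\mathrm{in}}}$, $V_A\in\mathbb{R}^{m\times Tr_{\mathrm{in}}}$ and $M^{(t)}_{\mathrm{target}}\in\mathbb{R}^{Tr_{\mathrm{in}}\times Tr_{\mathrm{in}}}$ be defined as in the context. Consider the full problem $$\text{(P)}\quad \min_{\substack{U\in\mathbb{R}^{n\times r},\,U^\top U=I_r\\ V\in\mathbb{R}^{m\times r},\,V^\top V=I_r\\ C^{(1)},\dots,C^{(T)}\in\mathbb{R}^{r\times r}}}\ \sum_{t=1}^T\left\|\Delta W^{(t)}_{\mathrm{target}}-U C^{(t)}V^\top\right\|_F^2$$ and the core problem $$\text{(Q)}\quad \min_{\substack{U_{\mathrm{core}}\in\mathbb{R}^{Tr_{\mathrm{in}}\times r},\,U_{\mathrm{core}}^\top U_{\mathrm{core}}=I_r\\ V_{\mathrm{core}}\in\mathbb{R}^{Tr_{\mathrm{in}}\times r},\,V_{\mathrm{core}}^\top V_{\mathrm{core}}=I_r\\ C_{\mathrm{core}}^{(1)},\dots,C_{\mathrm{core}}^{(T)}\in\mathbb{R}^{r\times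 r}}}\ \sum_{t=1}^T\left\|M^{(t)}_{\mathrm{target}}-U_{\mathrm{core}} C_{\mathrm{core}}^{(t)}V_{\mathrm{core}}^\top\right\|_F^2 .$$ (i) If $(U,V,\{C^{(t)}\}_{t=1}^T)$ is an optimal solution of (P) with $\mathrm{Col}(U)\subseteq\mathrm{Col}(U_B)$ and $\mathrm{Col}(V)\subseteq\mathrm{Col}(V_A)$, then $(U_B^\top U,\;V_A^\top V,\;\{C^{(t)}\}_{t=1}^T)$ is an optimal solution of (Q). (ii) Conversely, if $(U_{\mathrm{core}},V_{\mathrm{core}},\{C_{\mathrm{core}}^{(t)}\}_{t=1}^T)$ is any optimal solution of (Q), then $(U_BU_{\mathrm{core}},\;V_AV_{\mathrm{core}},\;\{C_{\mathrm{core}}^{(t)}\}_{t=1}^T)$ is an optimal solution of (P).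
   Context: $\mathrm{Col}(X)$ denotes the column space of $X$ and $\|\cdot\|_F$ the Frobenius norm. Targets: $\Delta W^{(t)}_{\mathrm{target}}=\lambda^{(t)}\,\dfrac{\Delta W^{(t)}}{\|\Delta W^{(t)}\|_F}$, where $\lambda^{(t)}=\beta\|\Delta W^{(t)}\|_F+(1-\beta)\,\dfrac1T\sum_{s=1}^T\|\Delta W^{(s)}\|_F$. Bases: $U_B$ is the left factor in a thin SVD $[B^{(1)},\dots,B^{(T)}]=U_B\Sigma_BV_B^\top$ of the horizontal concatenation (an $n\times Tr_{\mathrm{in}}$ matrix), and $V_A$ is the right factor in a thin SVD $[A^{(1)};\dots;A^{(T)}]=U_A\Sigma_AV_A^\top$ of the vertical concatenation (a $Tr_{\mathrm{in}}\times m$ matrix). Here $U_B^\top U_B=V_A^\top V_A=I_{Tr_{\mathrm{in}}}$, $\Sigma_B,\Sigma_A\in\mathbb{R}^{Tr_{\mathrm{in}}\times Tr_{\mathrm{in}}}$ are diagonal with nonnegative (possibly zero) entries, and $V_B,U_A$ are orthogonal $Tr_{\mathrm{in}}\times Tr_{\mathrm{in}}$ matrices. Core matrices: $M^{(t)}=U_B^\top\Delta W^{(t)}V_A=(U_B^\top B^{(t)})(A^{(t)}V_A)$, and the core targets are given by the same reweighting rule applied to the $M^{(t)}$: $M^{(t)}_{\mathrm{target}}=\mu^{(t)}\,\dfrac{M^{(t)}}{\|M^{(t)}\|_F}$ with $\mu^{(t)}=\beta\|M^{(t)}\|_F+(1-\beta)\,\dfrac1T\sum_{s=1}^T\|M^{(s)}\|_F$.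 *)

(* Defs.v *)
From mathcomp Require Import all_boot all_order all_algebra reals.

Set Implicit Arguments.
Unset Strict Implicit.
Unset Printing Implicit Defensive.

Import Order.TTheory GRing.Theory Num.Theory.
Local Open Scope ring_scope.

(* The norm that MathComp-Analysis puts on matrices is the maximum norm, hence
   a separate definition. *)
Definition frobenius (R : realType) (p q : nat) (X : 'M[R]_(p, q)) : R :=
  Num.sqrt (\sum_(i < p) \sum_(j < q) X i j ^+ 2).

(* Column spaces are row spaces of transposes for the %MS inclusion. *)
Definition colspace_sub (R : realType) (p q1 q2 : nat)
    (X : 'M[R]_(p, q1)) (Y : 'M[R]_(p, q2)) : Prop :=
  (X^T <= Y^T)%MS.

Definition orthonormal_cols (R : realType) (p q : nat) (X : 'M[R]_(p, q)) :
  Prop := X^T *m X = 1%:M.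

(* For a p x q matrix, "thin" means k = minn p q.  The singular values are
   allowed to vanish and are not required to be sorted.  When a factor is square
   (q = k or p = k), having orthonormal columns means being orthogonal. *)
Definition thin_svd (R : realType) (p q k : nat) (X : 'M[R]_(p, q))
    (U : 'M[R]_(p, k)) (S : 'M[R]_k) (V : 'M[R]_(q, k)) : Prop :=
  [/\ X = U *m S *m V^T,
      orthonormal_cols U,
      orthonormal_cols V,
      is_diag_mx S
    & forall i, 0 <= S i i].

Lemma sum_ord_const (T k : nat) : (\sum_(t < T) k = T * k)%N.
Proof. by rewrite sum_nat_const card_ord. Qed.

(* \mxrow and \mxcol have size \sum_(t < T) k, which is cast to T * k. *)
Definition hconcat (R : realType) (T n k : nat) (B : 'I_T -> 'M[R]_(n, k)) :
    'M[R]_(n, (T * k)%N) :=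
  castmx (erefl n, sum_ord_const T k) (\mxrow_(t < T) B t).

Definition vconcat (R : realType) (T k m : nat) (A : 'I_T -> 'M[R]_(k, m)) :
    'M[R]_((T * k)%N, m) :=
  castmx (sum_ord_const T k, erefl m) (\mxcol_(t < T) A t).

Definition reweight_norm (R : realType) (T p q : nat) (beta : R)
    (X : 'I_T -> 'M[R]_(p, q)) (t : 'I_T) : R :=
  beta * frobenius (X t)
  + (1 - beta) * (T%:R^-1 * \sum_(s < T) frobenius (X s)).

Definition target (R : realType) (T p q : nat) (beta : R)
    (X : 'I_T -> 'M[R]_(p, q)) (t : 'I_T) : 'M[R]_(p, q) :=
  (reweight_norm beta X t / frobenius (X t)) *: X t.

Definition core (R : realType) (T n m k : nat) (U_B : 'M[R]_(n, k))
    (V_A : 'M[R]_(m, k)) (W : 'I_T -> 'M[R]_(n, m)) (t : 'I_T) : 'M[R]_k :=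
  U_B^T *m W t *m V_A.

Definition objective (R : realType) (T p q r : nat) (X : 'I_T -> 'M[R]_(p, q))
    (U : 'M[R]_(p, r)) (V : 'M[R]_(q, r)) (C : 'I_T -> 'M[R]_r) : R :=
  \sum_(t < T) frobenius (X t - U *m C t *m V^T) ^+ 2.

Definition feasible (R : realType) (p q r : nat)
    (U : 'M[R]_(p, r)) (V : 'M[R]_(q, r)) : Prop :=
  orthonormal_cols U /\ orthonormal_cols V.

Definition optimal (R : realType) (T p q r : nat) (X : 'I_T -> 'M[R]_(p, q))
    (U : 'M[R]_(p, r)) (V : 'M[R]_(q, r)) (C : 'I_T -> 'M[R]_r) : Prop :=
  feasible U V /\
  forall (U' : 'M[R]_(p, r)) (V' : 'M[R]_(q, r)) (C' : 'I_T -> 'M[R]_r),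
    feasible U' V' -> objective X U V C <= objective X U' V' C'.

(* Main.v *)
Require Import Defs.
From mathcomp Require Import all_boot all_order all_algebra reals.

(* The thin SVDs give DW t = U_B U_B^T DW t V_A V_A^T, and multiplying by
   matrices with orthonormal columns preserves Frobenius norms, so the full and
   core targets satisfy X t = U_B M t V_A^T.
   Lifting a core candidate by U_B and V_A therefore preserves the objective.
   Conversely, compressing a full candidate U C V^T by U_B^T and V_A does not
   increase the residual; U_B^T U and V_A^T V need not have orthonormal columns,
   but since r <= T r_in their column spaces lie in those of matrices Q and P
   with r orthonormal columns, so the compressed product has the form Q D P^T. *)

Set Implicit Arguments.
Unset Strict Implicit.
Unset Printing Implicit Defensive.

Import Order.TTheory GRing.Theory Num.Theory.
Local Open Scope ring_scope.

(** * Frobenius norm under isometries and compressions *)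

Section Frobenius.
Variable R : realType.

Lemma frobenius_sqr p q (X : 'M[R]_(p, q)) : frobenius X ^+ 2 = \tr (X^T *m X).
Proof.
rewrite sqr_sqrtr; last by do 2 apply: sumr_ge0 => ? _; exact: sqr_ge0.
rewrite exchange_big; apply: eq_bigr => j _.
by rewrite mxE; apply: eq_bigr => i _; rewrite mxE expr2.
Qed.

Lemma frobenius_ge0 p q (X : 'M[R]_(p, q)) : 0 <= frobenius X.
Proof. exact: sqrtr_ge0. Qed.

Lemma frobenius_tr p q (X : 'M[R]_(p, q)) : frobenius X^T = frobenius X.
Proof.
rewrite /frobenius exchange_big; congr Num.sqrt.
by do 2 apply: eq_bigr => ? _; rewrite mxE.
Qed.

Lemma frobenius_isometry p q k (U : 'M[R]_(p, k)) (X : 'M[R]_(k, q)) :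
  orthonormal_cols U -> frobenius (U *m X) = frobenius X.
Proof.
move=> oU; apply/eqP; rewrite -(eqrXn2 (n := 2)) ?frobenius_ge0 //.
by rewrite !frobenius_sqr trmx_mul mulmxA -(mulmxA X^T) oU mulmx1.
Qed.

Lemma frobenius_isometry2 p q k l (U : 'M[R]_(p, k)) (X : 'M[R]_(k, l))
    (V : 'M[R]_(q, l)) :
  orthonormal_cols U -> orthonormal_cols V ->
  frobenius (U *m X *m V^T) = frobenius X.
Proof.
move=> oU oV; rewrite -mulmxA frobenius_isometry // -frobenius_tr.
by rewrite trmx_mul trmxK frobenius_isometry // frobenius_tr.
Qed.

Lemma frobenius_compress p q k (U : 'M[R]_(p, k)) (X : 'M[R]_(p, q)) :
  orthonormal_cols U -> frobenius (U^T *m X) ^+ 2 <= frobenius X ^+ 2.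
Proof.
move=> oU; rewrite -subr_ge0.
(* Pythagoras: the difference is the squared norm of X - U U^T X. *)
set Y := U *m (U^T *m X).
suff -> : frobenius X ^+ 2 - frobenius (U^T *m X) ^+ 2 =
          frobenius (X - Y) ^+ 2 by exact: sqr_ge0.
(* All three products equal the Gram matrix of [U^T *m X], so the expansion of
   [(X - Y)^T *m (X - Y)] collapses to a difference of two Gram matrices. *)
have XY : X^T *m Y = (U^T *m X)^T *m (U^T *m X).
  by rewrite trmx_mul trmxK -mulmxA.
have YX : Y^T *m X = (U^T *m X)^T *m (U^T *m X).
  by rewrite [Y^T]trmx_mul -mulmxA.
have YY : Y^T *m Y = (U^T *m X)^T *m (U^T *m X).
  by rewrite [Y^T]trmx_mul -mulmxA (mulmxA U^T) oU mul1mx.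
rewrite !frobenius_sqr -raddfB /=; congr (\tr _).
by rewrite [(X - Y)^T]raddfB mulmxBl !mulmxBr XY YX YY subrr subr0.
Qed.

Lemma frobenius_compress2 p q k l (U : 'M[R]_(p, k)) (X : 'M[R]_(p, q))
    (V : 'M[R]_(q, l)) :
  orthonormal_cols U -> orthonormal_cols V ->
  frobenius (U^T *m X *m V) ^+ 2 <= frobenius X ^+ 2.
Proof.
move=> oU oV; rewrite -mulmxA.
apply: le_trans (frobenius_compress _ oU) _.
(* Transposing turns the right factor [V] into a left compression by [V^T]. *)
by rewrite -frobenius_tr trmx_mul -(frobenius_tr X) frobenius_compress.
Qed.

End Frobenius.

(** * Orthonormal columns and Gram-Schmidt *)

Section Orthonormal.
Variable R : realType.

Lemma orthonormal_mul p q k (U : 'M[R]_(p, k)) (X : 'M[R]_(k, q)) :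
  orthonormal_cols U -> orthonormal_cols X -> orthonormal_cols (U *m X).
Proof.
move=> oU oX; rewrite /orthonormal_cols trmx_mul mulmxA -(mulmxA X^T).
by rewrite oU mulmx1.
Qed.

(** [U *m U^T] is the orthogonal projector onto the column space of [U]. *)
Lemma colspace_sub_proj p k l (U : 'M[R]_(p, k)) (X : 'M[R]_(p, l)) :
  orthonormal_cols U -> colspace_sub X U -> U *m (U^T *m X) = X.
Proof.
move=> oU /submxP[D eqX]; have -> : X = U *m D^T.
  by rewrite -[X]trmxK eqX trmx_mul trmxK.
by rewrite (mulmxA U^T) oU mul1mx.
Qed.

Lemma orthonormal_compress p k l (U : 'M[R]_(p, k)) (X : 'M[R]_(p, l)) :
  orthonormal_cols U -> colspace_sub X U -> orthonormal_cols X ->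
  orthonormal_cols (U^T *m X).
Proof.
move=> oU sXU oX.
by rewrite /orthonormal_cols trmx_mul trmxK -mulmxA colspace_sub_proj.
Qed.

(** Keeps Gram-Schmidt going when the residual [v] vanishes: since [r < p], some nonzero [w] is
    orthogonal to [Q], and [v] is 0 times it. *)
Lemma exists_orthogonal p r (Q : 'M[R]_(p, r)) (v : 'cV[R]_p) :
  (r < p)%N -> Q^T *m v = 0 ->
  exists (w : 'cV[R]_p) (a : R), [/\ w != 0, Q^T *m w = 0 & v = a *: w].
Proof.
move=> lt_rp Qv; have [v0|vN0] := eqVneq v 0; last first.
  by exists v, 1; rewrite scale1r.
have /rowV0Pn[u /sub_kermxP uQ uN0] : kermx Q != 0.
  rewrite -mxrank_eq0 mxrank_ker -lt0n subn_gt0.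
  exact: leq_ltn_trans (rank_leq_col Q) lt_rp.
exists u^T, 0; split; last by rewrite scale0r.
  by apply: contraNneq uN0 => u0; rewrite -[u]trmxK u0 trmx0.
by rewrite -trmx_mul uQ trmx0.
Qed.

Lemma normalize_col p (w : 'cV[R]_p) :
  w != 0 -> exists2 b : R, b != 0 & orthonormal_cols (b *: w).
Proof.
move=> wN0; have fE := frobenius_sqr w.
have fN0 : frobenius w != 0.
  apply: contra_neq wN0 => f0; apply/matrixP => i j; rewrite [RHS]mxE ord1.
  move/eqP: fE; rewrite f0 expr0n /= eq_sym /mxtrace big_ord1 mxE.
  rewrite psumr_eq0 => [/allP/(_ i)|k _]; last by rewrite mxE -expr2 sqr_ge0.
  by rewrite mem_index_enum mxE -expr2 sqrf_eq0 => /(_ isT)/eqP.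
exists (frobenius w)^-1; first by rewrite invr_eq0.
rewrite /orthonormal_cols [(_ *: w)^T]linearZ -scalemxAl -scalemxAr scalerA.
rewrite [w^T *m w]mx11_scalar -trace_mx11 -fE scale_scalar_mx.
by rewrite -expr2 exprVn mulVf // sqrf_eq0.
Qed.

(** Gram-Schmidt, one column at a time. [G] may be rank deficient; a dependent column is replaced by
    an arbitrary orthogonal direction, for which [r <= p] leaves room, so that [Q] has exactly [r]
    columns. *)
Lemma exists_orthonormal_colspace p r (G : 'M[R]_(p, r)) :
  (r <= p)%N ->
  exists2 Q : 'M[R]_(p, r), orthonormal_cols Q & colspace_sub G Q.
Proof.
elim: r G => [|r IHr] G lt_rp.
  by exists 0; [apply/matrixP => -[] | rewrite /colspace_sub [G^T]flatmx0 sub0mx].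
pose g : 'cV_p := lsubmx (G : 'M_(p, 1 + r)).
pose H : 'M_(p, r) := rsubmx (G : 'M_(p, 1 + r)).
have [Q oQ sHQ] := IHr H (ltnW lt_rp).
(* The residual of the new column [g] after projection onto the columns of [Q]. *)
have Qv : Q^T *m (g - Q *m (Q^T *m g)) = 0.
  by rewrite mulmxBr (mulmxA Q^T Q) oQ mul1mx subrr.
have [w [a [wN0 Qw vE]]] := exists_orthogonal lt_rp Qv.
have [b bN0 oq] := normalize_col wN0.
have wQ : w^T *m Q = 0 by rewrite -[Q]trmxK -trmx_mul Qw trmx0.
have oQ' : @orthonormal_cols R p (1 + r) (row_mx (b *: w) Q).
  rewrite /orthonormal_cols tr_row_mx mul_col_row oq oQ scalar_mx_block.
  by rewrite [(b *: w)^T]linearZ -scalemxAl wQ -scalemxAr Qw !scaler0.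
exists (row_mx (b *: w) Q : 'M_(p, 1 + r)) => //.
have -> : G = row_mx g H :> 'M_(p, 1 + r) by rewrite hsubmxK.
have sQ : (Q^T <= (row_mx (b *: w) Q)^T)%MS.
  by rewrite tr_row_mx -addsmxE addsmxSr.
have sw : (w^T <= (row_mx (b *: w) Q)^T)%MS.
  rewrite tr_row_mx -addsmxE; apply: submx_trans (addsmxSl _ _).
  by rewrite linearZ /= eqmx_scale.
suff : (col_mx g^T H^T <= (row_mx (b *: w) Q)^T)%MS by rewrite -tr_row_mx.
rewrite col_mx_sub (submx_trans sHQ sQ) andbT.
have -> : g = a *: w + Q *m (Q^T *m g) by rewrite -vE subrK.
rewrite linearD linearZ /= trmx_mul addmx_sub ?scalemx_sub //.
exact: mulmx_sub.
Qed.

End Orthonormal.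

(** * Passage between full and core problems *)

Section Compression.
Variables (R : realType) (T n m k r : nat).
Variables (X : 'I_T -> 'M[R]_(n, m)) (M : 'I_T -> 'M[R]_k).
Variables (U_B : 'M[R]_(n, k)) (V_A : 'M[R]_(m, k)).
Hypotheses (oU : orthonormal_cols U_B) (oV : orthonormal_cols V_A).
Hypothesis XE : forall t, X t = U_B *m M t *m V_A^T.

Lemma objective_lift (U V : 'M[R]_(k, r)) C :
  objective X (U_B *m U) (V_A *m V) C = objective M U V C.
Proof.
apply: eq_bigr => t _; congr (_ ^+ 2).
rewrite -(frobenius_isometry2 _ oU oV) XE mulmxBr mulmxBl trmx_mul.
by rewrite !mulmxA.
Qed.

Lemma feasible_lift (U V : 'M[R]_(k, r)) :
  feasible U V -> feasible (U_B *m U) (V_A *m V).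
Proof. by case=> oU' oV'; split; exact: orthonormal_mul. Qed.

Lemma objective_compress (U : 'M[R]_(n, r)) (V : 'M[R]_(m, r)) C :
  (r <= k)%N ->
  exists (Q P : 'M[R]_(k, r)) D,
    feasible Q P /\ objective M Q P D <= objective X U V C.
Proof.
move=> le_rk.
have [Q oQ sQ] := exists_orthonormal_colspace (U_B^T *m U) le_rk.
have [P oP sP] := exists_orthonormal_colspace (V_A^T *m V) le_rk.
(* [D t] is the compressed product [U_B^T *m (U *m C t *m V^T) *m V_A] in the coordinates of [Q] and
   [P]; the projectors of [Q] and [P] fix it, so nothing is lost. *)
exists Q, P, (fun t => Q^T *m (U_B^T *m U) *m C t *m (P^T *m (V_A^T *m V))^T).
split=> //; apply: ler_sum => t _.
have -> : M t - Q *m (Q^T *m (U_B^T *m U) *m C t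
            *m (P^T *m (V_A^T *m V))^T) *m P^T =
          U_B^T *m (X t - U *m C t *m V^T) *m V_A.
  have -> : Q *m (Q^T *m (U_B^T *m U) *m C t
              *m (P^T *m (V_A^T *m V))^T) *m P^T =
            (Q *m (Q^T *m (U_B^T *m U))) *m C t
              *m (P *m (P^T *m (V_A^T *m V)))^T.
    by rewrite (trmx_mul P) !mulmxA.
  rewrite !colspace_sub_proj // XE mulmxBr mulmxBl trmx_mul trmxK.
  congr (_ - _); last by rewrite !mulmxA.
  by rewrite -mulmxA -(mulmxA _ V_A^T) oV mulmx1 mulmxA oU mul1mx.
exact: frobenius_compress2.
Qed.

(** The inclusions make [U] and [V] the lifts of their compressions, so both sides of the core
    comparison are objectives of lifted candidates. *)
Lemma optimal_compress (U : 'M[R]_(n, r)) (V : 'M[R]_(m, r)) C :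
  optimal X U V C -> colspace_sub U U_B -> colspace_sub V V_A ->
  optimal M (U_B^T *m U) (V_A^T *m V) C.
Proof.
move=> [[oU' oV'] optU] sU sV; split; first by split; exact: orthonormal_compress.
move=> U' V' C' fU'; rewrite -!objective_lift !colspace_sub_proj //.
exact/optU/feasible_lift.
Qed.

Lemma optimal_lift (U V : 'M[R]_(k, r)) C :
  (r <= k)%N -> optimal M U V C -> optimal X (U_B *m U) (V_A *m V) C.
Proof.
move=> le_rk [fU optU]; split; first exact: feasible_lift.
move=> U' V' C' _; rewrite objective_lift.
have [Q [P [D [fQ leD]]]] := objective_compress U' V' C' le_rk.
exact: le_trans (optU _ _ D fQ) leD.
Qed.

End Compression.

(** * Factorization of the targets through the bases *)

Section Target.
Variable R : realType.

Lemma thin_svd_proj_left p q k (X : 'M[R]_(p, q)) (U : 'M[R]_(p, k)) S V :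
  thin_svd X U S V -> U *m U^T *m X = X.
Proof.
by case=> -> oU _ _ _; rewrite -!mulmxA (mulmxA U^T) oU mul1mx.
Qed.

Lemma thin_svd_proj_right p q k (X : 'M[R]_(p, q)) (U : 'M[R]_(p, k)) S V :
  thin_svd X U S V -> X *m (V *m V^T) = X.
Proof. by case=> -> _ oV _ _; rewrite mulmxA -(mulmxA _ V^T) oV mulmx1. Qed.

Lemma hconcat_fixed T n k (B : 'I_T -> 'M[R]_(n, k)) (F : 'M[R]_n) :
  F *m hconcat B = hconcat B -> forall t, F *m B t = B t.
Proof.
(* Destructing the size equation makes the cast an identity, so that blocks can be compared. *)
rewrite /hconcat; case: _ / (sum_ord_const T k); rewrite castmx_id mul_mxrow.
by move/eq_mxrowP => + t => /(_ t).
Qed.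

Lemma vconcat_fixed T k m (A : 'I_T -> 'M[R]_(k, m)) (F : 'M[R]_m) :
  vconcat A *m F = vconcat A -> forall t, A t *m F = A t.
Proof.
rewrite /vconcat; case: _ / (sum_ord_const T k); rewrite castmx_id mxcol_mul.
by move/eq_mxcolP => + t => /(_ t).
Qed.

(** The reweighting factors depend only on Frobenius norms, which agree for [W] and its core, so the
    same scalar multiplies both sides. *)
Lemma target_core T n m k beta (W : 'I_T -> 'M[R]_(n, m)) (U : 'M[R]_(n, k))
    (V : 'M[R]_(m, k)) :
  orthonormal_cols U -> orthonormal_cols V ->
  (forall t, W t = U *m core U V W t *m V^T) ->
  forall t, target beta W t = U *m target beta (core U V W) t *m V^T.
Proof.
move=> oU oV WE.
have fE t : frobenius (core U V W t) = frobenius (W t).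
  by rewrite [in RHS]WE frobenius_isometry2.
move=> t; rewrite /target /reweight_norm -scalemxAr -scalemxAl -WE fE.
by under [in RHS]eq_bigr do rewrite fE.
Qed.

End Target.

Theorem theorem4p3 (R : realType) (n m T rin r : nat)
  (hn : (1 <= n)%N) (hm : (1 <= m)%N) (hT : (1 <= T)%N)
  (hrin : (1 <= rin)%N) (hr : (1 <= r)%N)
  (hr_le : (r <= T * rin)%N) (hTrin_le : (T * rin <= minn n m)%N)
  (beta : R) (hbeta0 : 0 <= beta) (hbeta1 : beta <= 1)
  (B : 'I_T -> 'M[R]_(n, rin)) (A : 'I_T -> 'M[R]_(rin, m))
  (hBA : forall t, B t *m A t <> 0)
  (U_B : 'M[R]_(n, (T * rin)%N)) (S_B V_B : 'M[R]_(T * rin)%N)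
  (hsvdB : thin_svd (hconcat B) U_B S_B V_B)
  (U_A S_A : 'M[R]_(T * rin)%N) (V_A : 'M[R]_(m, (T * rin)%N))
  (hsvdA : thin_svd (vconcat A) U_A S_A V_A) :
  let DW := fun t => B t *m A t in
  let DW_target := target beta DW in
  let M_target := target beta (core U_B V_A DW) in
  (forall (U : 'M[R]_(n, r)) (V : 'M[R]_(m, r)) (C : 'I_T -> 'M[R]_r),
     optimal DW_target U V C ->
     colspace_sub U U_B -> colspace_sub V V_A ->
     optimal M_target (U_B^T *m U) (V_A^T *m V) C)
  /\
  (forall (U_core V_core : 'M[R]_((T * rin)%N, r)) (C_core : 'I_T -> 'M[R]_r),
     optimal M_target U_core V_core C_core ->
     optimal DW_target (U_B *m U_core) (V_A *m V_core) C_core).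
Proof.
move=> DW DW_target M_target.
have [_ oU _ _ _] := hsvdB; have [_ _ oV _ _] := hsvdA.
(* The left projector fixes every [B t] and the right one every [A t], since each fixes the whole
   concatenation. *)
have DWE t : DW t = U_B *m core U_B V_A DW t *m V_A^T.
  rewrite /core /DW !mulmxA.
  rewrite (hconcat_fixed (thin_svd_proj_left hsvdB)) -2!mulmxA.
  by rewrite (vconcat_fixed (thin_svd_proj_right hsvdA)).
have XE := target_core beta oU oV DWE.
split=> [U V C|U V C]; first exact: optimal_compress.
exact: optimal_lift.
Qed.
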